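(* Let $\mathbb{H}$ be a complex Hilbert space and let $T\in B(\mathbb{H})$. Then $$w^2(T)\le\frac14\|T\|\,\|T^2\|^{\frac12}+\frac14\|T^2\|+\frac12\|T\|^2.$$
   Context: $B(\mathbb{H})$ is the set of bounded linear operators on $\mathbb{H}$, and $\|\cdot\|$ is the operator norm. The numerical radius of $T\in B(\mathbb{H})$ is $w(T)=\sup\{|\langle Tx,x\rangle| : x\in\mathbb{H},\ \|x\|=1\}$, and $w^2(T)$ means $(w(T))^2$. *)

(* Defs.v *)
From HB Require Import structures.
From mathcomp Require Import all_boot all_order all_algebra.
From mathcomp Require Import complex.
From mathcomp Require Import boolp classical_sets reals topology normedtype.

Set Implicit Arguments.
Unset Strict Implicit.
Unset Printing Implicit Defensive.

Import Order.TTheory GRing.Theory Num.Theory.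
Import numFieldNormedType.Exports.

Local Open Scope classical_set_scope.
Local Open Scope ring_scope.
Local Open Scope complex_scope.

(* A complex Hilbert space: a complete normed space over R[i] whose norm comes
   from a positive definite sesquilinear form, linear in its first argument and
   conjugate-linear in the second. The zero space is allowed. *)
HB.mixin Record isComplexHilbert (R : realType) H
    & CompleteNormedModule R[i] H := {
  inner : {dot H for Num.conj} ;
  inner_normE : forall x : H, inner x x = `|x| ^+ 2
}.

#[short(type="complexHilbertType")]
HB.structure Definition ComplexHilbert (R : realType) :=
  {H of CompleteNormedModule R[i] H & isComplexHilbert R H}.

Section Operators.
Variables (R : realType) (H : complexHilbertType R).
Implicit Types T : H -> H.

(* The library's norms on H and on R[i] take values in R[i]; they are real and
   nonnegative, so their real parts lose nothing and suprema can be taken in R. *)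
Definition hnorm (x : H) : R := complex.Re `|x|.

Definition cmod (z : R[i]) : R := complex.Re `|z|.

Definition bounded_operator T : Prop :=
  exists M : R, forall x, hnorm (T x) <= M * hnorm x.

(* sup is 0 on sets without a supremum. For a bounded linear T, the set in
   opnorm has one, and so does the set in numerical_radius, except that the
   latter is empty when H = 0, giving the usual value w(T) = 0. *)
Definition opnorm T : R := sup [set hnorm (T x) | x in [set x | hnorm x <= 1]].

Definition numerical_radius T : R :=
  sup [set cmod (inner (T x) x) | x in [set x | hnorm x = 1]].

End Operators.

(* Main.v *)
Require Import Defs.
From mathcomp Require Import all_boot all_order all_algebra.
From mathcomp Require Import complex.
From mathcomp Require Import sesquilinear ring lra.
From mathcomp Require Import boolp classical_sets reals topology normedtype.

(** Write [a] and [b] for the norms of [T] and of [T \o T]. The inequality follows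
from the stronger [w(T)^2 <= (a^2 + b) / 2]: since [b <= a^2], the square root
of [b] is at most [a], so [b <= a * sqrt b], and half of [b / 2] may be replaced
by [a * sqrt b / 4].

The stronger bound is the special case [u = T x], [v = T^* x] of Buzano's
inequality [2 |<u, x> <x, v>| <= |u| |v| + |<u, v>|], and it is obtained here
without the adjoint. For a unit vector [x], put [c = <T x, x>] and
[v = T x - 2 c x]. Up to sign, [v] is the reflection of [T x] in the line
spanned by [x], so it has the same norm as [T x] ([hnorm_reflect]). Applying [T]
gives [<T v, x> = <T^2 x, x> - 2 c^2], whence
[2 |c|^2 <= |<T^2 x, x>| + |<T v, x>| <= b + a |v| <= b + a^2]
([double_numerical_value_le], [numerical_value_sqr_le]). Taking the supremum over
[x] gives [numerical_radius_sqr_le]. *)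

Set Implicit Arguments.
Unset Strict Implicit.
Unset Printing Implicit Defensive.

Import Order.TTheory GRing.Theory Num.Theory.

Local Open Scope classical_set_scope.
Local Open Scope ring_scope.

(** Subtracting [n] times the projection of [u] onto a unit vector [x] is
contracting for [n = 1], which is the Cauchy-Schwarz inequality against [x], and
isometric for [n = 2], which is a reflection up to sign. *)
Lemma dnormB_proj (C : numClosedFieldType) (U : lmodType C)
    (form : {dot U for Num.conj}) (u x : U) (n : nat) (x1 : form x x = 1) :
  form (u - (n%:R * form u x) *: x) (u - (n%:R * form u x) *: x) =
    form u u - (2 * n%:R - n%:R ^+ 2) * `|form u x| ^+ 2.
Proof.
rewrite dnormB dnormZ x1 linearZr_LR /= normrM normr_nat.
rewrite !rmorphM !rmorph_nat /= conjCK exprMn normCK.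
ring.
Qed.

Section HilbertNorm.
Variables (R : realType) (H : complexHilbertType R).
Implicit Types (x u : H) (z : R[i]).

Lemma hnormC x : (hnorm x)%:C%C = `|x|.
Proof. by rewrite RRe_real // normr_real. Qed.

Lemma cmodC z : (cmod z)%:C%C = `|z|.
Proof. by rewrite RRe_real // normr_real. Qed.

Lemma hnorm_ge0 x : 0 <= hnorm x.
Proof. by rewrite -ler0c hnormC. Qed.

Lemma cmod_ge0 z : 0 <= cmod z.
Proof. by rewrite -ler0c cmodC. Qed.

Lemma hnorm0 : hnorm (0 : H) = 0.
Proof. by rewrite /hnorm normr0. Qed.

Lemma hnorm_eq0 x : hnorm x = 0 -> x = 0.
Proof. by move=> h; apply/eqP; rewrite -normr_eq0 -hnormC h. Qed.

Lemma hnormZ (a : R) x : 0 <= a -> hnorm (a%:C%C *: x) = a * hnorm x.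
Proof.
move=> a0; apply: (@complexI R).
by rewrite hnormC normrZ ger0_norm ?ler0c // -hnormC rmorphM.
Qed.

Lemma hnorm_subproj (n : nat) u x : hnorm x = 1 ->
  hnorm (u - (n%:R * inner u x) *: x) ^+ 2 =
    hnorm u ^+ 2 - (2 * n%:R - n%:R ^+ 2) * cmod (inner u x) ^+ 2.
Proof.
move=> x1.
have x1' : inner x x = 1 by rewrite inner_normE -hnormC x1 expr1n.
apply: (@complexI R).
rewrite rmorphB [X in _ = _ - X]rmorphM !rmorphXn rmorphB rmorphM !rmorphXn /=.
rewrite !hnormC cmodC -!inner_normE dnormB_proj //.
by rewrite !rmorph_nat.
Qed.

Lemma cmod_inner_le u x : hnorm x = 1 -> cmod (inner u x) <= hnorm u.
Proof.
move=> x1; rewrite -(@ler_pXn2r _ 2) ?nnegrE ?hnorm_ge0 ?cmod_ge0 //.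
have := hnorm_subproj 1 u x1.
have := sqr_ge0 (hnorm (u - (1%:R * inner u x) *: x)).
lra.
Qed.

Lemma hnorm_reflect u x : hnorm x = 1 ->
  hnorm (u - (2 * inner u x) *: x) = hnorm u.
Proof.
move=> x1; apply/eqP.
rewrite -(@eqrXn2 _ 2) ?hnorm_ge0 //; apply/eqP.
by rewrite (hnorm_subproj 2 u x1); ring.
Qed.

(** Buzano's inequality with the adjoint eliminated: [2 c^2] is the difference of
the inner products with [x] of [T (T x)] and of [T] applied to the reflected
vector, and Cauchy-Schwarz bounds both. *)
Lemma double_numerical_value_le (T : {linear H -> H}) x : hnorm x = 1 ->
  2 * cmod (inner (T x) x) ^+ 2 <=
    hnorm (T (T x)) + hnorm (T (T x - (2 * inner (T x) x) *: x)).
Proof.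
move=> x1; set c := inner (T x) x; set v := T x - _.
have Tv : inner (T v) x = inner (T (T x)) x - 2 * c ^+ 2.
  by rewrite linearB linearZ /= linearBl linearZl_LR /= -/c; ring.
apply: (@le_trans _ _ (cmod (inner (T (T x)) x) + cmod (inner (T v) x)));
  last by apply: lerD; exact: cmod_inner_le.
rewrite -lecR rmorphD /= !cmodC rmorphM rmorphXn /= cmodC rmorph_nat -normrX.
have {1}-> : 2 = `|2 : R[i]| by rewrite normr_nat.
rewrite -normrM.
have -> : 2 * c ^+ 2 = inner (T (T x)) x - inner (T v) x by rewrite Tv; ring.
exact: ler_normB.
Qed.

End HilbertNorm.

Section OperatorNorm.
Variables (R : realType) (H : complexHilbertType R).
Implicit Types (T : {linear H -> H}) (x : H).

(** Boundedness of [T] is what makes the supremum defining [opnorm T] an actual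
upper bound. *)
Lemma hnorm_le_opnorm_ball T x : bounded_operator T -> hnorm x <= 1 ->
  hnorm (T x) <= opnorm T.
Proof.
move=> [M hM] x1; apply: ub_le_sup; last by exists x.
(* The bound M may be negative when H is the zero space. *)
exists `|M| => _ [y /= y1 <-]; apply: (le_trans (hM y)).
apply: (@le_trans _ _ (`|M| * hnorm y)).
  by rewrite ler_wpM2r ?hnorm_ge0 // ler_norm.
by rewrite ler_piMr.
Qed.

Lemma opnorm_ge0 T : bounded_operator T -> 0 <= opnorm T.
Proof.
move=> hT; apply: (le_trans (hnorm_ge0 (T 0))).
by apply: hnorm_le_opnorm_ball => //; rewrite hnorm0.
Qed.

Lemma opnorm_le T (a : R) : (forall x, hnorm x <= 1 -> hnorm (T x) <= a) ->
  opnorm T <= a.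
Proof.
move=> h; apply: ge_sup; last by move=> _ [y /= y1 <-]; exact: h.
by exists (hnorm (T 0)); exists 0 => //=; rewrite hnorm0.
Qed.

Lemma hnorm_le_opnorm T x : bounded_operator T ->
  hnorm (T x) <= opnorm T * hnorm x.
Proof.
move=> hT; have [/hnorm_eq0 ->|x0] := eqVneq (hnorm x) 0.
  by rewrite linear0 hnorm0 mulr0.
have xgt0 : 0 < hnorm x by rewrite lt_def x0 hnorm_ge0.
have i0 : 0 <= (hnorm x)^-1 by rewrite invr_ge0 hnorm_ge0.
rewrite -ler_pdivrMr // mulrC -hnormZ // -linearZ /=.
by apply: hnorm_le_opnorm_ball; rewrite // hnormZ // mulVf.
Qed.

Lemma bounded_operator_comp (S T : H -> H) :
  bounded_operator S -> bounded_operator T -> bounded_operator (S \o T).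
Proof.
move=> [M hM] [N hN]; exists (`|M| * N) => x /=.
apply: (le_trans (hM _)); apply: (@le_trans _ _ (`|M| * hnorm (T x))).
  by rewrite ler_wpM2r ?hnorm_ge0 // ler_norm.
by rewrite -mulrA ler_wpM2l.
Qed.

Lemma opnorm_sqr_le T : bounded_operator T ->
  opnorm (T \o T) <= opnorm T ^+ 2.
Proof.
move=> hT; apply: (@opnorm_le (T \o T)) => x x1 /=.
apply: (le_trans (hnorm_le_opnorm _ hT)).
by rewrite expr2 ler_wpM2l ?opnorm_ge0 // hnorm_le_opnorm_ball.
Qed.

Lemma numerical_value_sqr_le T x : bounded_operator T -> hnorm x = 1 ->
  cmod (inner (T x) x) ^+ 2 <= (opnorm (T \o T) + opnorm T ^+ 2) / 2.
Proof.
move=> hT x1; have hTT := bounded_operator_comp hT hT.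
have := double_numerical_value_le T x1.
have : hnorm (T (T x)) <= opnorm (T \o T).
  by apply: (@hnorm_le_opnorm_ball (T \o T)); rewrite // x1.
have := hnorm_le_opnorm (T x - (2 * inner (T x) x) *: x) hT.
rewrite hnorm_reflect //.
have : opnorm T * hnorm (T x) <= opnorm T ^+ 2.
  by rewrite expr2 ler_wpM2l ?opnorm_ge0 // hnorm_le_opnorm_ball // x1.
lra.
Qed.

Lemma numerical_radius_sqr_le T : bounded_operator T ->
  numerical_radius T ^+ 2 <= (opnorm (T \o T) + opnorm T ^+ 2) / 2.
Proof.
move=> hT; set r := _ / 2.
have r0 : 0 <= r.
  rewrite divr_ge0 // addr_ge0 ?sqr_ge0 //.
  exact: (@opnorm_ge0 (T \o T) (bounded_operator_comp hT hT)).
rewrite /numerical_radius; set W := image _ _.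
have Wr : ubound W (Num.sqrt r).
  move=> _ [x /= x1 <-]; rewrite -(ger0_norm (cmod_ge0 _)) -sqrtr_sqr.
  by rewrite ler_wsqrtr // numerical_value_sqr_le.
(* W is empty exactly when H is the zero space. *)
have [->|/set0P W0] := eqVneq W set0; first by rewrite sup0 expr0n.
have w0 : 0 <= sup W.
  have [y Wy] := W0; have [x _ xy] := Wy; apply: (@le_trans _ _ y).
    by rewrite -xy cmod_ge0.
  by apply: ub_le_sup Wy; exists (Num.sqrt r).
rewrite -[leRHS]sqr_sqrtr // ler_pXn2r ?nnegrE ?sqrtr_ge0 //.
exact: ge_sup.
Qed.

End OperatorNorm.

Theorem theorem2p7 (R : realType) (H : complexHilbertType R)
    (T : {linear H -> H}) (hT : bounded_operator T) :
  numerical_radius T ^+ 2 <=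
    4^-1 * opnorm T * Num.sqrt (opnorm (T \o T))
    + 4^-1 * opnorm (T \o T) + 2^-1 * opnorm T ^+ 2.
Proof.
have a0 := opnorm_ge0 hT.
have b0 : 0 <= opnorm (T \o T).
  exact: (@opnorm_ge0 _ _ (T \o T) (bounded_operator_comp hT hT)).
have s_le : Num.sqrt (opnorm (T \o T)) <= opnorm T.
  by rewrite -[leRHS](ger0_norm a0) -sqrtr_sqr ler_wsqrtr // opnorm_sqr_le.
have s0 := sqrtr_ge0 (opnorm (T \o T)).
have sE := sqr_sqrtr b0.
have := numerical_radius_sqr_le hT.
have : opnorm (T \o T) <= opnorm T * Num.sqrt (opnorm (T \o T)).
  by rewrite -[leLHS]sE expr2 ler_wpM2r.
lra.
Qed.
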